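(* Let $\Gamma$ be a connected divisible design graph with parameters $(v,k,\lambda_1,\lambda_2,m,n)$, where $\lambda_1=k$. Then the vertex connectivity of $\Gamma$ equals $k$.
   Context: All graphs are finite, simple and undirected. A $k$-regular graph on $v=mn$ vertices is called a divisible design graph (DDG) with parameters $(v,k,\lambda_1,\lambda_2,m,n)$ if its vertex set can be partitioned into $m$ classes of size $n$ such that two distinct vertices from the same class have exactly $\lambda_1$ common neighbours, and two vertices from different classes have exactly $\lambda_2$ common neighbours. The vertex connectivity $\varkappa(G)$ of a graph $G$ is the minimum number of vertices whose deletion from $G$ disconnects it; by convention the complete graph on $s$ vertices has vertex connectivity $s-1$. *)

(* Defs.v *)
From mathcomp Require Import all_boot.
Set Implicit Arguments.
Unset Strict Implicit.
Unset Printing Implicit Defensive.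

(* A simple graph on a finite vertex type T is its adjacency relation e : rel T,
   assumed symmetric and irreflexive. *)

Definition nbhd (T : finType) (e : rel T) (x : T) : {set T} := [set z | e x z].

Definition regular_graph (T : finType) (e : rel T) (k : nat) : Prop :=
  forall x : T, #|nbhd e x| = k.

Definition complete_graph (T : finType) (e : rel T) : bool :=
  [forall x, forall y, (x != y) ==> e x y].

Definition induced (T : finType) (e : rel T) (A : {set T}) : rel T :=
  [rel x y | [&& x \in A, y \in A & e x y]].

Definition connected_on (T : finType) (e : rel T) (A : {set T}) : bool :=
  [forall x in A, forall y in A, connect (induced e A) x y].

(* The graph with no vertices is not connected. *)
Definition connected_graph (T : finType) (e : rel T) : bool :=
  (0 < #|T|) && connected_on e [set: T].

(* Deleting S leaves two vertices in different components; in particular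
   deleting all vertices but one does not count as disconnecting. *)
Definition disconnecting (T : finType) (e : rel T) (S : {set T}) : bool :=
  ~~ connected_on e (~: S).

(* The default value setT of the arg min is not used when the graph is not
   complete, by disconnecting_exists below. *)
Definition vertex_connectivity (T : finType) (e : rel T) : nat :=
  if complete_graph e then #|T|.-1
  else #|[arg min_(S < [set: T] | disconnecting e S) #|S|]|.

Definition divisible_design_graph (T : finType) (e : rel T)
    (v k lambda1 lambda2 m n : nat) : Prop :=
  [/\ #|T| = v, v = m * n, regular_graph e k &
    exists P : {set {set T}},
      [/\ partition P [set: T],
          #|P| = m,
          (forall C : {set T}, C \in P -> #|C| = n),
          (forall (C : {set T}) (x y : T), C \in P -> x \in C -> y \in C ->
             x != y -> #|nbhd e x :&: nbhd e y| = lambda1) &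
          (forall (C D : {set T}) (x y : T), C \in P -> D \in P -> C != D ->
             x \in C -> y \in D -> #|nbhd e x :&: nbhd e y| = lambda2)]].

Lemma disconnecting_exists (T : finType) (e : rel T) :
  irreflexive e -> ~~ complete_graph e ->
  exists S : {set T}, disconnecting e S.
Proof.
move=> irr_e /forallPn[x /forallPn[y]]; rewrite negb_imply => /andP[xy nexy].
exists (~: [set x; y]); rewrite /disconnecting setCK.
apply/negP => /forall_inP/(_ x); rewrite set21 => /(_ isT).
move=> /forall_inP/(_ y); rewrite set22 => /(_ isT) /connectP[p].
case: p => [|z p] /=; first by move=> _ eyx; rewrite eyx eqxx in xy.
case/andP; rewrite /induced /= => /and3P[_ zxy exz] _ _; rewrite !inE in zxy.
by case/orP: zxy exz => /eqP->; rewrite ?irr_e ?(negbTE nexy).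
Qed.

Lemma vertex_connectivity_min (T : finType) (e : rel T) :
  irreflexive e -> ~~ complete_graph e ->
  (exists2 S : {set T}, disconnecting e S & #|S| = vertex_connectivity e) /\
  (forall S : {set T}, disconnecting e S -> vertex_connectivity e <= #|S|).
Proof.
move=> irr_e ncomp; rewrite /vertex_connectivity (negbTE ncomp).
have [S0 dS0] := disconnecting_exists irr_e ncomp.
rewrite /arg_min /extremum; case: pickP => [S /andP[dS /forall_inP minS] | none] /=.
  by split; [exists S | move=> S' /minS].
case: (arg_minnP (fun S : {set T} => #|S|) dS0) => S dS minS.
by move: (none S); rewrite /= dS => /forall_inP[].
Qed.

(* Main.v *)
(** Let [S] separate [A] from [B].  Since [lambda1 = k], vertices in one class are
twins, so one may enlarge [A] and [B] to unions of classes (if some class meets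
both, the common neighbourhood of its vertices lies in [S], and [k <= #|S|]).
Write [a], [b], [s] for the sizes of [A], [B], [S] and suppose [s < k]; as [n]
divides both, [s <= k - n].  The function [z |-> #|N(z) :&: A|] vanishes on [B],
sums to [k a], and its squares sum to [a (n k + (a - n) lambda2)].  With
[k^2 = n k + (v - n) lambda2], Cauchy-Schwarz on the complement of [B] gives
[(a - n) (b - n) lambda2 <= n k (s - (k - n)) <= 0].  If [a = n] or [b = n], this
side is a single class, whose neighbourhood lies in [S]; if [lambda2 = 0] then
[k = n] and [s = 0], against connectedness. *)
Require Import Defs.
From mathcomp Require Import all_boot.
From mathcomp Require Import zify.

Set Implicit Arguments.
Unset Strict Implicit.
Unset Printing Implicit Defensive.

(** * Cauchy-Schwarz and double counting *)

Lemma sqr_sum_leq (I : finType) (D : {set I}) (f : I -> nat) :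
  (\sum_(i in D) f i) ^ 2 <= #|D| * \sum_(i in D) f i ^ 2.
Proof.
(* After doubling, both sides are double sums, compared termwise by [2 f_i f_j <= f_i^2 + f_j^2]. *)
rewrite -(leq_pmul2l (isT : 0 < 2)).
have -> : 2 * (\sum_(i in D) f i) ^ 2 =
          \sum_(i in D) \sum_(j in D) 2 * (f i * f j).
  rewrite -mulnn big_distrlr /= big_distrr /=.
  by apply: eq_bigr => i _; rewrite big_distrr.
have -> : 2 * (#|D| * \sum_(i in D) f i ^ 2) =
          \sum_(i in D) \sum_(j in D) (f i ^ 2 + f j ^ 2).
  under [RHS]eq_bigr do rewrite big_split sum_nat_const /=.
  by rewrite big_split /= sum_nat_const -big_distrr /= mul2n -addnn.
by apply: leq_sum => i _; apply: leq_sum => j _; apply: nat_Cauchy.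
Qed.

Lemma card_setI_sum (T : finType) (A B : {set T}) :
  #|A :&: B| = \sum_(x in B) (x \in A).
Proof.
rewrite -sum1_card big_mkcond [RHS]big_mkcond /=.
by apply: eq_bigr => x _; rewrite inE; case: (x \in A); case: (x \in B).
Qed.

Lemma sum_nbhd_setI (T : finType) (e : rel T) (A : {set T}) : symmetric e ->
  \sum_z #|nbhd e z :&: A| = \sum_(x in A) #|nbhd e x|.
Proof.
move=> sym_e; under eq_bigr do rewrite card_setI_sum.
rewrite exchange_big /=; apply: eq_bigr => x _.
rewrite -sum1_card [RHS]big_mkcond /=; apply: eq_bigr => z _.
by rewrite !inE sym_e; case: (e x z).
Qed.

(** Both sides count the triples of [x], [y] in [A] and a common neighbour [z]. *)
Lemma sum_sqr_nbhd_setI (T : finType) (e : rel T) (A : {set T}) : symmetric e ->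
  \sum_z #|nbhd e z :&: A| ^ 2 =
  \sum_(x in A) \sum_(y in A) #|nbhd e x :&: nbhd e y|.
Proof.
move=> sym_e.
under eq_bigr do rewrite -mulnn card_setI_sum big_distrlr /=.
rewrite exchange_big /=; apply: eq_bigr => x _.
rewrite exchange_big /=; apply: eq_bigr => y _.
rewrite -sum1_card [RHS]big_mkcond /=; apply: eq_bigr => z _.
by rewrite !inE (sym_e z x) (sym_e z y); case: (e x z); case: (e y z).
Qed.

(* The separated sides have [n + a] and [n + b] vertices, so that no subtraction
   occurs; the separator has [c]. *)
Lemma separator_arith k mu n a b c :
  0 < a -> 0 < b -> 0 < c -> c + n <= k ->
  k * k = n * k + (n + a + b + c) * mu ->
  k ^ 2 * (n + a) <= (n + a + c) * (n * k + a * mu) -> False.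
Proof.
move=> a_gt0 b_gt0 c_gt0 le_ck sqk; rewrite -mulnn sqk => CS.
have le_nk : n * k * (c + n) <= n * (k * k) by rewrite mulnA leq_mul2l le_ck orbT.
rewrite sqk in le_nk.
(* After cancellation [CS] reads [(a * b + n * (n + a + b + c)) * mu <= c * n * k], and [le_nk]
   bounds [c * n * k] by [n * (n + a + b + c) * mu]. *)
have prod0 : a * b * mu = 0 by lia.
have mu0 : mu = 0.
  case: (posnP mu) => // mu_gt0.
  have abmu_gt0 : 0 < a * b * mu by rewrite !muln_gt0 a_gt0 b_gt0.
  by rewrite prod0 in abmu_gt0.
(* With [mu = 0] the square [k * k] is [n * k], which would force [c * k = 0]. *)
have : (c + n) * k <= k * k by rewrite leq_mul2r le_ck orbT.
have : 0 < c * k by rewrite muln_gt0 c_gt0; lia.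
by rewrite sqk mu0; lia.
Qed.

(** * Saturated sets: unions of classes of a partition *)

Definition saturated (T : finType) (P : {set {set T}}) (A : {set T}) : Prop :=
  forall x y, x \in A -> y \in pblock P x -> y \in A.

Section Partition.

Context (T : finType) (P : {set {set T}}).
Hypothesis partP : partition P [set: T].

Lemma mem_pblock_self x : x \in pblock P x.
Proof. by rewrite mem_pblock (cover_partition partP). Qed.

Lemma pblock_in x : pblock P x \in P.
Proof. by rewrite pblock_mem // (cover_partition partP). Qed.

Lemma pblock_same x y : y \in pblock P x -> pblock P y = pblock P x.
Proof. by move/same_pblock; apply; have /and3P[] := partP. Qed.

(** The classes contained in [A] partition it. *)
Lemma saturated_dvd n A :
  {in P, forall C : {set T}, #|C| = n} -> saturated P A -> n %| #|A|.
Proof.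
move=> cardP satA.
have partA : partition [set C in P | C \subset A] A.
  have /and3P[_ trivP nP0] := partP.
  apply/and3P; split; last by rewrite inE (negbTE nP0).
    rewrite eqEsubset; apply/andP; split.
      by apply/bigcupsP => C; rewrite inE => /andP[].
    apply/subsetP => x xA; apply/bigcupP; exists (pblock P x).
      by rewrite inE pblock_in; apply/subsetP => y; apply: satA.
    exact: mem_pblock_self.
  by apply: trivIsetS trivP; apply/subsetP => C; rewrite inE => /andP[].
rewrite (@card_uniform_partition _ n _ _ _ partA) ?dvdn_mull //.
by move=> C; rewrite inE => /andP[/cardP].
Qed.

Lemma saturated_bigcup (A : {set T}) : saturated P (\bigcup_(x in A) pblock P x).
Proof.
move=> x y /bigcupP[z zA xz] yx; apply/bigcupP; exists z => //.
by rewrite -(pblock_same xz).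
Qed.

End Partition.

(** * Twin classes: codegree counts and the lower bound on separators *)

Section TwinClasses.

Context (T : finType) (e : rel T) (P : {set {set T}}) (k mu n : nat).
Hypothesis sym_e : symmetric e.
Hypothesis irr_e : irreflexive e.
Hypothesis partP : partition P [set: T].
Hypothesis cardP : {in P, forall C : {set T}, #|C| = n}.
(** This packs both codegree conditions, with [lambda1 = k], together with regularity, which is the
    case [y = x]. *)
Hypothesis codeg : forall x y,
  #|nbhd e x :&: nbhd e y| = if y \in pblock P x then k else mu.

Lemma card_nbhd x : #|nbhd e x| = k.
Proof. by have := codeg x x; rewrite setIid mem_pblock_self. Qed.

(** Both neighbourhoods have size [k], and so does their intersection. *)
Lemma nbhd_pblock x y : y \in pblock P x -> nbhd e y = nbhd e x.
Proof.
move=> xy; have := codeg x y; rewrite xy => cardI.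
have Ix : nbhd e x :&: nbhd e y = nbhd e x.
  by apply/eqP; rewrite eqEcard subsetIl cardI card_nbhd /=.
have Iy : nbhd e x :&: nbhd e y = nbhd e y.
  by apply/eqP; rewrite eqEcard subsetIr cardI card_nbhd /=.
by rewrite -Iy Ix.
Qed.

Lemma pblock_coclique x y : y \in pblock P x -> e x y = false.
Proof.
by move=> /nbhd_pblock/setP/(_ y); rewrite !inE irr_e.
Qed.

(** A neighbourhood is saturated, since twins have the same neighbours. *)
Lemma dvdn_degree (x : T) : n %| k.
Proof.
rewrite -(card_nbhd x); apply: (saturated_dvd partP cardP) => z w.
rewrite !inE => xz /nbhd_pblock/setP/(_ x).
by rewrite !inE !(sym_e _ x) => ->.
Qed.

Lemma sum_codegree (A : {set T}) x : x \in A -> saturated P A ->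
  \sum_(y in A) #|nbhd e x :&: nbhd e y| = n * k + (#|A| - n) * mu.
Proof.
move=> xA satA; under eq_bigr do rewrite codeg.
have subA : pblock P x \subset A by apply/subsetP => y; apply: satA.
have cardx : #|pblock P x| = n by apply/cardP/pblock_in.
rewrite (big_setID (pblock P x)) /= (setIidPr subA).
congr (_ + _); first by under eq_bigr => y -> do []; rewrite sum_nat_const cardx.
rewrite (eq_bigr (fun=> mu)) => [|y]; last by rewrite inE => /andP[/negbTE->].
by rewrite sum_nat_const cardsD (setIidPr subA) cardx.
Qed.

(** Walks of length two from [x] are counted by middle vertex and by endpoint. *)
Lemma sqr_degree (x : T) : k * k = n * k + (#|T| - n) * mu.
Proof.
rewrite -cardsT -(@sum_codegree _ x) ?inE //.
transitivity (\sum_(z in nbhd e x) #|nbhd e z|).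
  by under eq_bigr do rewrite card_nbhd; rewrite sum_nat_const card_nbhd.
rewrite -sum_nbhd_setI //.
by apply: eq_big => [z|z _]; rewrite ?inE // setIC.
Qed.

Lemma separated_leq (A B : {set T}) x : x \in A -> saturated P A ->
  {in A & B, forall u w, ~~ e u w} ->
  k ^ 2 * #|A| <= #|~: B| * (n * k + (#|A| - n) * mu).
Proof.
move=> xA satA noAB.
(* Vertices of [B] have no neighbour in [A], so restricting to [~: B] loses nothing, for the sum and
   for the sum of squares. *)
have sumAB (f : nat -> nat) : f 0 = 0 ->
    \sum_(z in ~: B) f #|nbhd e z :&: A| = \sum_z f #|nbhd e z :&: A|.
  move=> f0; rewrite [LHS]big_mkcond /=; apply: eq_bigr => z _.
  rewrite inE; case: ifPn => // /negPn zB.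
  rewrite (_ : nbhd e z :&: A = set0) ?cards0 ?f0 //.
  apply/setP => u; rewrite !inE sym_e; apply/negP => /andP[euz uA].
  by have := noAB u z uA zB; rewrite euz.
have := sqr_sum_leq (~: B) (fun z => #|nbhd e z :&: A|).
rewrite (sumAB id) // (sumAB (fun i => i ^ 2)) // sum_nbhd_setI //.
under eq_bigr do rewrite card_nbhd; rewrite sum_nat_const.
rewrite sum_sqr_nbhd_setI //.
under eq_bigr => y yA do rewrite (sum_codegree yA satA).
(* A common factor [#|A|], positive because of [x], is cancelled. *)
rewrite sum_nat_const expnMn mulnCA [#|A| ^ 2]expnS -mulnA.
by rewrite leq_pmul2l ?expn1 1?mulnC //; apply/card_gt0P; exists x.
Qed.

(** Here [A] is a single class, hence a coclique, so the neighbours of [x] avoid both [A] and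
    [B]. *)
Lemma class_nbhd_sub (A B : {set T}) x : x \in A -> saturated P A ->
  {in A & B, forall u w, ~~ e u w} -> #|A| = n -> k <= #|~: (A :|: B)|.
Proof.
move=> xA satA noAB cardA.
have defA : pblock P x = A.
  apply/eqP; rewrite eqEcard cardA cardP ?pblock_in // leqnn andbT.
  by apply/subsetP => y; apply: satA.
rewrite -(card_nbhd x); apply/subset_leq_card/subsetP => z.
rewrite !inE negb_or => exz; apply/andP; split.
  by apply/negP => zA; rewrite pblock_coclique ?defA in exz.
by apply/negP => zB; have := noAB x z xA zB; rewrite exz.
Qed.

Lemma saturated_separator_leq (A B : {set T}) x y :
  x \in A -> y \in B -> saturated P A -> saturated P B -> [disjoint A & B] ->
  {in A & B, forall u w, ~~ e u w} -> ~: (A :|: B) != set0 ->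
  k <= #|~: (A :|: B)|.
Proof.
move=> xA yB satA satB disAB noAB; rewrite -card_gt0.
have noBA : {in B & A, forall u w, ~~ e u w}.
  by move=> u w uB wA; rewrite sym_e noAB.
have classA := class_nbhd_sub xA satA noAB.
have := class_nbhd_sub yB satB noBA; rewrite setUC => classB.
have block_leq (D : {set T}) z : z \in D -> saturated P D -> n <= #|D|.
  move=> zD satD; rewrite -(cardP (pblock_in partP z)).
  by apply/subset_leq_card/subsetP => w; apply: satD.
have nA := block_leq _ _ xA satA; have nB := block_leq _ _ yB satB.
have satS : saturated P (~: (A :|: B)).
  move=> u w; rewrite !inE => + wu.
  have uw : u \in pblock P w by rewrite (pblock_same partP wu) mem_pblock_self.
  by apply: contra => /orP[/satA/(_ uw)->|/satB/(_ uw)->]; rewrite ?orbT.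
have /dvdnP[s defs] := saturated_dvd partP cardP satS.
have /dvdnP[q defk] := dvdn_degree x.
have CS := separated_leq xA satA noAB.
have sqk := sqr_degree x.
have cardU : #|A :|: B| = #|A| + #|B|.
  by rewrite cardsU (disjoint_setI0 disAB) cards0 subn0.
have cardS : #|A| + #|B| + #|~: (A :|: B)| = #|T| by rewrite -cardU cardsC.
have cardB : #|~: B| = #|A| + #|~: (A :|: B)|.
  by have := cardsC B; move: cardS; clear; lia.
move: CS; rewrite cardB.
move: (#|A|) (#|B|) (#|~: (A :|: B)|) (#|T|) nA nB cardS classA classB defs sqk.
move=> a b c v nA nB cardS classA classB defs sqk CS c_gt0.
rewrite leqNgt; apply/negP => lt_ck.
have n_gt0 : 0 < n by case: (n) defs lt_ck c_gt0; lia.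
(* Both [c] and [k] are multiples of [n], so [c < k] leaves a gap of at least [n]. *)
have le_ck : c + n <= k.
  move: lt_ck; rewrite defs defk ltn_pmul2r // => lt_sq.
  by rewrite -mulSnr leq_pmul2r.
have ltA : n < a.
  by rewrite ltn_neqAle nA andbT; apply/eqP => /esym/classA; rewrite leqNgt lt_ck.
have ltB : n < b.
  by rewrite ltn_neqAle nB andbT; apply/eqP => /esym/classB; rewrite leqNgt lt_ck.
apply: (@separator_arith k mu n (a - n) (b - n) c); rewrite ?subn_gt0 //.
  by rewrite sqk -cardS; congr (_ + _ * _); lia.
by rewrite subnKC.
Qed.

Lemma disconnecting_leq (S : {set T}) :
  connected_on e [set: T] -> disconnecting e S -> k <= #|S|.
Proof.
move=> conn /forall_inPn[x xS /forall_inPn[y yS ncxy]].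
(* [A0] is the component of [x] after the deletion of [S], and [B0] collects all other remaining
   vertices. *)
pose A0 := [set z in ~: S | connect (induced e (~: S)) x z].
pose B0 := [set z in ~: S | ~~ connect (induced e (~: S)) x z].
have xA0 : x \in A0 by rewrite inE xS connect0.
have yB0 : y \in B0 by rewrite inE yS.
have noAB0 : {in A0 & B0, forall u w, ~~ e u w}.
  move=> u w; rewrite !inE => /andP[uS cxu] /andP[wS]; apply: contra => euw.
  by apply/(connect_trans cxu)/connect1; rewrite /induced /= !inE uS wS.
have defS z : z \notin S -> (z \in A0) || (z \in B0).
  by move=> zS; rewrite !inE zS /= orbN.
pose A := \bigcup_(z in A0) pblock P z; pose B := \bigcup_(z in B0) pblock P z.
have subA : A0 \subset A.
  by apply/subsetP => z zA; apply/bigcupP; exists z; rewrite ?mem_pblock_self.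
have subB : B0 \subset B.
  by apply/subsetP => z zB; apply/bigcupP; exists z; rewrite ?mem_pblock_self.
(* Replacing both ends of an edge by twins would give an edge from [A0] to [B0]. *)
have noAB : {in A & B, forall u w, ~~ e u w}.
  move=> u w /bigcupP[u0 u0A /nbhd_pblock Nu] /bigcupP[w0 w0B /nbhd_pblock Nw].
  apply: contra (noAB0 u0 w0 u0A w0B) => euw.
  have : w \in nbhd e u0 by rewrite -Nu inE.
  rewrite inE sym_e => ewu0.
  have : u0 \in nbhd e w0 by rewrite -Nw inE.
  by rewrite inE sym_e.
have [disAB | ] := boolP [disjoint A & B]; last first.
  (* A class meeting both sides: a common neighbour of [u] and [w] outside [S] would be joined to
     the opposite side. *)
  case/pred0Pn => z /andP[/= /bigcupP[u uA zu] /bigcupP[w wB zw]].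
  have Nuw : nbhd e u = nbhd e w by rewrite -(nbhd_pblock zu) (nbhd_pblock zw).
  rewrite -(card_nbhd u); apply/subset_leq_card/subsetP => t tu.
  have tw : t \in nbhd e w by rewrite -Nuw.
  rewrite !inE in tu tw; apply/negPn/negP => /defS/orP[tA | tB].
    by have := noAB0 t w tA wB; rewrite sym_e tw.
  by have := noAB0 u t uA tB; rewrite tu.
have subS : ~: (A :|: B) \subset S.
  rewrite subCset; apply/subsetP => z; rewrite !inE => /defS.
  by case/orP => [/(subsetP subA)->|/(subsetP subB)->]; rewrite ?orbT.
apply: leq_trans (subset_leq_card subS).
have xA := subsetP subA x xA0; have yB := subsetP subB y yB0.
apply: (saturated_separator_leq xA yB) => //; try exact: saturated_bigcup.
(* If nothing were left between [A] and [B], then [A] would be closed under adjacency and by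
   connectedness contain [y]. *)
apply/negP => /eqP/setP S0.
have AB u : u \notin A -> u \in B.
  by move=> /negbTE uA; have := S0 u; rewrite !inE uA /= => /negbFE.
have closedA : closed (induced e [set: T]) A.
  move=> u w /and3P[_ _ euw]; apply/idP/idP => [uA | wA]; apply/negPn/negP => /AB.
    by move=> wB; have := noAB u w uA wB; rewrite euw.
  by move=> uB; have := noAB w u wA uB; rewrite sym_e euw.
have := forall_inP (forall_inP conn x (in_setT x)) y (in_setT y).
move/(closed_connect closedA); rewrite xA => /esym yA.
by have := disjointFr disAB yA; rewrite yB.
Qed.

End TwinClasses.

(** For the upper bound: deleting its neighbours isolates [x], while [y] survives. *)
Lemma disconnecting_nbhd (T : finType) (e : rel T) (x y : T) :
  irreflexive e -> x != y -> ~~ e x y -> disconnecting e (nbhd e x).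
Proof.
move=> irr_e xy nexy; apply/negP => /forall_inP/(_ x).
rewrite !inE irr_e => /(_ isT)/forall_inP/(_ y); rewrite !inE => /(_ nexy).
case/connectP => -[|z p] /=; first by move=> _ eyx; rewrite eyx eqxx in xy.
by rewrite /induced /= !inE => /andP[/and3P[_ /negbTE->]].
Qed.

Theorem proposition6 (T : finType) (e : rel T)
    (v k lambda1 lambda2 m n : nat) :
  symmetric e -> irreflexive e ->
  connected_graph e ->
  divisible_design_graph e v k lambda1 lambda2 m n ->
  lambda1 = k ->
  vertex_connectivity e = k.
Proof.
move=> sym_e irr_e /andP[/card_gt0P[x0 _] conn].
move=> [_ _ reg [P [partP _ cardP same diff]]] lambda1k.
have codeg x y :
    #|nbhd e x :&: nbhd e y| = if y \in pblock P x then k else lambda2.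
  case: ifPn => [yx | yNx].
    have [<- | xy] := eqVneq x y; first by rewrite setIid reg.
    by rewrite (same _ _ _ (pblock_in partP x)) ?mem_pblock_self.
  apply: (diff _ _ _ _ (pblock_in partP x) (pblock_in partP y));
    rewrite ?mem_pblock_self //.
  by apply: contra yNx => /eqP->; rewrite mem_pblock_self.
(* In a complete graph [x0] is adjacent to all other vertices, so [k] is the conventional value. *)
have [comp | ncomp] := boolP (complete_graph e).
  rewrite /vertex_connectivity comp -(reg x0) -(cardsC1 x0).
  apply: eq_card => z; rewrite !inE eq_sym.
  have [<- | xz] := eqVneq x0 z; first by rewrite irr_e.
  by have /forallP/(_ x0)/forallP/(_ z)/implyP/(_ xz)-> := comp.
have [[S dS <-] minS] := vertex_connectivity_min irr_e ncomp.
apply/eqP; rewrite eqn_leq (disconnecting_leq sym_e irr_e partP cardP codeg) //.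
rewrite andbT.
have /forallPn[x /forallPn[y]] := ncomp; rewrite negb_imply => /andP[xy nexy].
by rewrite -(reg x); apply/minS/(disconnecting_nbhd irr_e xy).
Qed.
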